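(* Fix an integer $r \geq 2$ and let $c$ be the unique positive real solution of $c = 1 - e^{-cr}$. There exists a function $g(n) = o(n)$ such that, as $n \to \infty$, with probability $1 - o(1)$ a random DFA with $n$ states over an alphabet of size $r$ has exactly one closed communicating class, this closed communicating class is aperiodic, and its size $M$ satisfies $|M - cn| \leq g(n)$.
   Context: A DFA is a tuple $A = \langle \Sigma, Q, q_0, \tau, \phi\rangle$ with finite alphabet $\Sigma$, finite state set $Q$, initial state $q_0 \in Q$, transition function $\tau : Q \times \Sigma \to Q$ and termination function $\phi : Q \to \{0,1\}$. Extend $\tau$ to strings in the usual way and write $\tau_\star(S) = \{\tau(q,x) : q \in S, x \in \Sigma^\star\}$ and $\tau_1(S) = \{\tau(q,\sigma) : q \in S, \sigma \in \Sigma\}$ for $S \subseteq Q$. Two states $q, q'$ communicate if each is reachable from the other by some string; this is an equivalence relation whose classes are the communicating classes. A communicating class $Q'$ is closed if $\tau_\star(Q') = Q'$. For $k > 1$, a closed communicating class $Q'$ is $k$-periodic if there is a partition of $Q'$ into $k$ nonempty parts $Q'_0, \ldots, Q'_{k-1}$ with $\tau_1(Q'_i) = Q'_{(i+1) \bmod k}$ for all $0 \leq i \leq k-1$; it is aperiodic if it is not $k$-periodic for any $k > 1$. A random DFA with $n$ states over an alphabet $\Sigma$ of size $r$ is obtained as follows: $Q = [n]$, the initial state is uniform in $Q$, each $\tau(q,\sigma)$ ($q \in Q$, $\sigma \in \Sigma$) is uniform in $Q$, each $\phi(q)$ is uniform in $\{0,1\}$, all choices mutually independent. *)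

(* Defs.v *)
From HB Require Import structures.
From mathcomp Require Import all_boot all_order all_algebra.
From mathcomp Require Import all_classical all_reals all_analysis.
Set Implicit Arguments. Unset Strict Implicit. Unset Printing Implicit Defensive.
Import Order.TTheory GRing.Theory Num.Theory.
Local Open Scope ring_scope.

(* A DFA with state set Q = [n] = 'I_n over alphabet Sigma = 'I_r:
   (initial state, transition function tau, termination function phi). *)
Definition dfa (n r : nat) : finType :=
  ('I_n * {ffun 'I_n * 'I_r -> 'I_n} * {ffun 'I_n -> bool})%type.

Definition trans n r (A : dfa n r) : {ffun 'I_n * 'I_r -> 'I_n} := A.1.2.

Definition run n r (tau : {ffun 'I_n * 'I_r -> 'I_n}) (q : 'I_n) (x : seq 'I_r) : 'I_n :=
  foldl (fun p s => tau (p, s)) q x.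

Definition reachable n r (tau : {ffun 'I_n * 'I_r -> 'I_n}) (p q : 'I_n) : Prop :=
  exists x : seq 'I_r, run tau p x = q.

Definition communicate n r (tau : {ffun 'I_n * 'I_r -> 'I_n}) (p q : 'I_n) : Prop :=
  reachable tau p q /\ reachable tau q p.

Definition comm_class n r (tau : {ffun 'I_n * 'I_r -> 'I_n}) (C : {set 'I_n}) : Prop :=
  exists q, forall p, p \in C <-> communicate tau q p.

Definition tau_star_fixed n r (tau : {ffun 'I_n * 'I_r -> 'I_n}) (S : {set 'I_n}) : Prop :=
  forall q', (exists q x, q \in S /\ run tau q x = q') <-> q' \in S.

Definition closed_comm_class n r (tau : {ffun 'I_n * 'I_r -> 'I_n}) (C : {set 'I_n}) : Prop :=
  comm_class tau C /\ tau_star_fixed tau C.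

Definition tau_one_eq n r (tau : {ffun 'I_n * 'I_r -> 'I_n}) (S T : {set 'I_n}) : Prop :=
  forall q', q' \in T <-> (exists q s, q \in S /\ tau (q, s) = q').

Definition k_periodic n r (tau : {ffun 'I_n * 'I_r -> 'I_n}) (C : {set 'I_n}) (k : nat) : Prop :=
  (1 < k)%N /\
  exists P : 'I_k -> {set 'I_n},
    (forall i, P i != finset.set0) /\
    (forall i j, i != j -> [disjoint P i & P j]) /\
    (\bigcup_(i < k) P i = C) /\
    (forall i, tau_one_eq tau (P i) (P (ordS i))).

Definition aperiodic n r (tau : {ffun 'I_n * 'I_r -> 'I_n}) (C : {set 'I_n}) : Prop :=
  forall k, (1 < k)%N -> ~ k_periodic tau C k.

(* Probability of an event under the uniform random DFA model: the initial state,
   all transitions and all termination bits are independent and uniform, i.e.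
   the DFA is uniform on the finite set dfa n r. *)
Definition prob_dfa {R : realType} (n r : nat) (E : dfa n r -> Prop) : R :=
  (#|[set A : dfa n r | `[< E A >]]|%:R / #|dfa n r|%:R).

(* Main.v *)
Require Import Defs.
From HB Require Import structures.
From mathcomp Require Import all_boot all_order all_algebra.
From mathcomp Require Import all_classical all_reals all_analysis.
From mathcomp Require Import zify ring lra.
From mathcomp Require Import fintype finset.
Import Order.TTheory GRing.Theory Num.Theory.
Import numFieldNormedType.Exports.
Set Implicit Arguments.
Unset Strict Implicit.
Unset Printing Implicit Defensive.
Local Open Scope ring_scope.

(* First-moment method. A closed communicating class C satisfies tau(C x Sigma) = C, and the
   probability that a uniform map sends A onto B is at most
   (e^t - 1)^|B| |A|! / (t n)^|A| for every t > 0. With t = r m / n, the expected number of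
   closed classes of size m is, up to a factor O(m), the binomial probability
   P(Bin(n, 1 - e^(-r m/n)) = m), which is exponentially small unless m/n is close to a root
   of x = 1 - e^(-r x); sizes m < n/(8 e) are excluded by the choice t = r. The equation of c
   forces r (1 - c) < 1, hence c > 1/2, so two closed classes would intersect: uniqueness is
   free. For a periodic class with parts P_i, the same computation with
   tau(P_i x Sigma) = P_(i+1) replaces (r m)! by the product of the (r |P_i|)!. Since
   |P_(i+1)| <= r |P_i|, some prefix P_0, ..., P_(j-1) has between 6 and m - 6 states, and
   summing over all ordered partitions with such a cut gains a factor O(m^-3). *)

(** * Uniform random functions *)

Section UniformFunctions.
Variables (R : realType) (Y X : finType).
Implicit Types (f g : {ffun Y -> X}) (J A : {set Y}) (B : {set X}).
Implicit Types P Q : pred {ffun Y -> X}.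

Definition pr P : R := #|[set f | P f]|%:R / #|{ffun Y -> X}|%:R.

Definition patch J f g : {ffun Y -> X} :=
  [ffun y => if y \in J then f y else g y].

Definition depends_on J P :=
  forall f g, {in J, f =1 g} -> P f = P g.

Lemma pr_ge0 P : 0 <= pr P.
Proof. by rewrite divr_ge0 ?ler0n. Qed.

Lemma pr_sub P Q : (forall f, P f -> Q f) -> pr P <= pr Q.
Proof.
move=> PQ; rewrite ler_wpM2r ?invr_ge0 ?ler0n // ler_nat subset_leq_card //.
by apply/subsetP => f; rewrite !inE; apply: PQ.
Qed.

(** Union bound over a list, so that it serves finite types, enumerated partitions and explicit
    lists of events alike. *)
Lemma pr_le_sum (I : Type) (s : seq I) (W : pred I) (F : I -> pred {ffun Y -> X}) P :
  (forall f, P f -> has (fun i => W i && F i f) s) ->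
  pr P <= \sum_(i <- s | W i) pr (F i).
Proof.
move=> PF; rewrite /pr -mulr_suml ler_wpM2r ?invr_ge0 ?ler0n //.
rewrite -natr_sum ler_nat.
apply: (@leq_trans #|[set f | has (fun i => W i && F i f) s]|).
  by apply: subset_leq_card; apply/subsetP => f; rewrite !inE; apply: PF.
elim: s {PF} => [|i s IH].
  by rewrite big_nil leqn0 cards_eq0; apply/eqP/setP => f; rewrite !inE.
rewrite big_cons; case: (boolP (W i)) => Wi.
  apply: (leq_trans _ (leq_add (leqnn _) IH)).
  apply: (leq_trans _ (leq_card_setU _ _)); apply: subset_leq_card.
  by apply/subsetP => f; rewrite !inE /= Wi.
apply: (leq_trans _ IH); apply: subset_leq_card.
by apply/subsetP => f; rewrite !inE /= (negbTE Wi).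
Qed.

(** Exchanging the values on [J] of two functions is an involution of the pairs. It matches the
    pairs whose first component satisfies both [P] and [Q] with the pairs [(f, g)] such that [P f]
    and [Q g]. *)
Lemma pr_indep J P Q : depends_on J P -> depends_on (~: J) Q ->
  pr (predI P Q) = pr P * pr Q.
Proof.
move=> dP dQ; pose swap (u : {ffun Y -> X} * {ffun Y -> X}) :=
  (patch J u.1 u.2, patch J u.2 u.1).
have swapK : involutive swap.
  by case=> f g; rewrite /swap /=; congr (_, _); apply/ffunP => y; rewrite !ffunE; case: (y \in J).
have -> : pr (predI P Q) = #|setX [set f | predI P Q f] [set: {ffun Y -> X}]|%:R
    / (#|{ffun Y -> X}|%:R * #|{ffun Y -> X}|%:R).
  rewrite cardsX cardsT natrM /pr; case: (eqVneq #|{ffun Y -> X}| 0%N) => [->|n0].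
    by rewrite !mul0r invr0 !mulr0.
  by rewrite -mulf_div divff ?mulr1 // pnatr_eq0.
rewrite /pr mulf_div; congr (_ / _); rewrite -natrM -cardsX; congr (_%:R).
rewrite -(card_imset _ (inv_inj swapK)); apply: eq_card => -[f g].
rewrite -[(f, g)]swapK (mem_imset _ _ (inv_inj swapK)) !inE /= !andbT.
congr andb; [apply: dP|apply: dQ] => y.
  by move=> yJ; rewrite !ffunE yJ.
by rewrite inE !ffunE => /negbTE ->.
Qed.

Lemma pr_const_on J (b : X) :
  pr (fun f : {ffun Y -> X} => [forall (y | y \in J), f y == b]) = #|X|%:R ^- #|J|.
Proof.
have X0 : #|X|%:R != 0 :> R.
  by rewrite pnatr_eq0 -lt0n; apply/card_gt0P; exists b.
have -> : #|X|%:R ^- #|J| = #|X|%:R ^+ #|~: J| / #|X|%:R ^+ #|Y| :> R.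
  by rewrite -(cardsC J) exprD invfM mulrCA divff ?mulr1 // expf_neq0.
rewrite /pr card_ffun natrX; congr (_ / _); rewrite -natrX; congr (_%:R).
pose F (y : Y) : pred X := fun x => (y \in J) ==> (x == b).
have -> : #|[set f : {ffun Y -> X} | [forall (y | y \in J), f y == b]]| = #|family F|.
  apply: eq_card => f; rewrite !inE; apply/forallP/familyP => h y; exact: h.
rewrite card_family foldrE big_map big_enum /= (bigID (mem J)) /= big1 ?mul1n.
  rewrite (eq_bigr (fun=> #|X|)) ?prod_nat_const.
    by congr expn; apply: eq_card => y; rewrite !inE.
  by move=> y /negbTE yJ; apply: eq_card => x; rewrite /F unfold_in yJ.
by move=> y yJ; rewrite -(card1 b); apply: eq_card => x; rewrite /F unfold_in /= yJ.
Qed.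

End UniformFunctions.

Lemma sum_subsets_card (T : finType) (V : nmodType) (A : {set T}) (W : pred nat) (F : nat -> V) :
  \sum_(J : {set T} | (J \subset A) && W #|J|) F #|J| =
  \sum_(j < #|A|.+1 | W j) F j *+ 'C(#|A|, j).
Proof.
rewrite (partition_big (fun J : {set T} => inord #|J| : 'I_(#|A|.+1)) (fun j => W j)).
  apply: eq_bigr => j Wj; rewrite -cards_draws -sumr_const.
  have jE (J : {set T}) : J \subset A -> (inord #|J| == j) = (#|J| == j :> nat).
    by move=> JA; rewrite -val_eqE /= inordK // ltnS subset_leq_card.
  apply: eq_big => [J|J /andP[/andP[JA _]]]; last by rewrite jE // => /eqP ->.
  rewrite !inE; case: (boolP (J \subset A)) => //= JA; rewrite jE //.
  by case: eqP => [->|_]; rewrite ?Wj ?andbF.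
by move=> J /andP[JA WJ]; rewrite inordK // ltnS subset_leq_card.
Qed.

Lemma expR_partial_sum (R : realType) (t : R) N : 0 <= t ->
  \sum_(i < N) t ^+ i / i`!%:R <= expR t.
Proof.
move=> t0; rewrite -(big_mkord xpredT (fun i => t ^+ i / i`!%:R)).
apply: (@nondecreasing_cvgn_le _ (series (exp_coeff t))).
  apply: nondecreasing_series => i _ _.
  by rewrite /exp_coeff /= divr_ge0 ?exprn_ge0 ?ler0n.
exact: is_cvg_series_exp_coeff.
Qed.

(** * Images of sets under a uniform random function *)

Section Onto.
Variables (R : realType) (Y X : finType).
Local Notation pr := (@pr R Y X).

Lemma pr_le1 P : pr P <= 1.
Proof.
rewrite /pr; case: (eqVneq #|{ffun Y -> X}| 0%N) => [->|n0].
  by rewrite invr0 mulr0 ler01.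
by rewrite ler_pdivrMr ?mul1r ?ler_nat ?max_card // ltr0n lt0n.
Qed.

(** The number of surjections from a [k]-set to an [l]-set is [k!] times the coefficient of [z^k] in
    [(e^z - 1)^l], and this coefficient is at most [(e^t - 1)^l / t^k]. The induction proves this
    bound by removing one point of [B] at a time. *)
Lemma pr_onto (t : R) (A : {set Y}) (B : {set X}) : 0 < t ->
  pr (fun f : {ffun Y -> X} => f @: A == B) <=
  (expR t - 1) ^+ #|B| * #|A| `!%:R / (t * #|X|%:R) ^+ #|A|.
Proof.
move=> t0; have et0 : 0 <= expR t - 1 by rewrite subr_ge0 ltW // expR_gt1.
have [m] := ubnP #|B|; elim: m A B => // m IH A B ltBm.
case: (set_0Vmem B) => [->|[b bB]].
  rewrite cards0 expr0 mul1r.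
  have [->|[a aA]] := set_0Vmem A.
    by rewrite cards0 fact0 expr0 divr1 pr_le1.
  rewrite (_ : pr _ = 0).
    by rewrite divr_ge0 ?exprn_ge0 ?mulr_ge0 ?ler0n // ltW.
  apply/eqP; rewrite eq_le pr_ge0 andbT (_ : 0 = pr xpred0).
    apply: pr_sub => f /eqP fA; suff : f a \in set0 by rewrite inE.
    by rewrite -fA; apply: imset_f.
  by rewrite /pr (_ : [set f | _] = set0) ?cards0 ?mul0r //; apply/setP => f; rewrite !inE.
have n0 : #|X|%:R != 0 :> R.
  by rewrite pnatr_eq0 -lt0n; apply/card_gt0P; exists b.
(* [J] is the fibre of [b] in [A], nonempty because [b] is in the image. The two conditions concern
   [f] on [J] and off [J], hence are independent. *)
pose F (J : {set Y}) : pred {ffun Y -> X} :=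
  predI (fun f : {ffun Y -> X} => [forall (y | y \in J), f y == b])
    (fun f : {ffun Y -> X} => f @: (A :\: J) == B :\ b).
apply: (@le_trans _ _ (\sum_(J : {set Y} | (J \subset A) && (0 < #|J|)%N) pr (F J))).
  apply: pr_le_sum => f /eqP fA; apply/hasP; exists (A :&: f @^-1: [set b]).
    by rewrite mem_index_enum.
  apply/andP; split; first rewrite subsetIl /=.
    apply/card_gt0P; move: bB; rewrite -fA => /imsetP[y yA ->].
    by exists y; rewrite !inE yA eqxx.
  apply/andP; split.
    by apply/forallP => y; apply/implyP; rewrite !inE => /andP[].
  apply/eqP/setP => x; rewrite !inE -fA; apply/imsetP/andP.
    case=> y; rewrite !inE negb_and; case: (boolP (y \in A)) => //= yA.
    by rewrite andbT => nb ->; split => //; apply: imset_f.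
  case=> xb /imsetP[y yA xE]; exists y => //.
  by rewrite !inE yA /= andbT -xE.
pose G j : R := (expR t - 1) ^+ #|B|.-1 / #|X|%:R ^+ #|A| *
   ((#|A| - j)`!%:R / t ^+ (#|A| - j)).
apply: (@le_trans _ _ (\sum_(J : {set Y} | (J \subset A) && (0 < #|J|)%N) G #|J|)).
  apply: ler_sum => J /andP[JA _]; rewrite /F (@pr_indep _ _ _ J); first last.
  - move=> f g fg; congr (_ == _); apply: eq_in_imset => y.
    by rewrite inE => /andP[yJ _]; apply: fg; rewrite inE.
  - move=> f g fg; apply: eq_forallb => y.
    by case: (boolP (y \in J)) => //= yJ; rewrite fg.
  rewrite pr_const_on; have cB : #|B :\ b| = #|B|.-1 by rewrite (cardsD1 b B) bB.
  have cA : #|A :\: J| = (#|A| - #|J|)%N by rewrite cardsD (setIidPr JA).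
  apply: (le_trans (ler_wpM2l _ (IH (A :\: J) (B :\ b) _))).
  - by rewrite invr_ge0 exprn_ge0 ?ler0n.
  - by rewrite cB prednK //; apply/card_gt0P; exists b.
  rewrite cB cA /G exprMn -[in X in _ <= X](subnKC (subset_leq_card JA)) exprD addKn.
  rewrite le_eqVlt; apply/orP; left; apply/eqP; field.
  by rewrite !expf_neq0 ?(gt_eqF t0).
rewrite sum_subsets_card.
have tn0 : t != 0 by rewrite gt_eqF.
have -> : \sum_(j < #|A|.+1 | (0 < j)%N) G j *+ 'C(#|A|, j) =
  (expR t - 1) ^+ #|B|.-1 * #|A| `!%:R / (t * #|X|%:R) ^+ #|A| *
  \sum_(j < #|A|.+1 | (0 < j)%N) t ^+ j / j`!%:R.
  rewrite mulr_sumr; apply: eq_bigr => j _.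
  have jA : (j <= #|A|)%N by rewrite -ltnS.
  have tA : t ^+ #|A| = t ^+ j * t ^+ (#|A| - j) by rewrite -exprD subnKC.
  rewrite /G -[LHS]mulr_natr -(bin_fact jA) !natrM exprMn tA.
  field; rewrite !expf_neq0 // pnatr_eq0 -lt0n fact_gt0 //.
rewrite [in leRHS](cardsD1 b B) bB exprS (_ : #|B :\ b| = #|B|.-1); last first.
  by rewrite (cardsD1 b B) bB.
rewrite [leRHS](_ : _ = (expR t - 1) ^+ #|B|.-1 * #|A| `!%:R / (t * #|X|%:R) ^+ #|A|
   * (expR t - 1)); last by ring.
apply: ler_wpM2l.
  by rewrite divr_ge0 ?exprn_ge0 // mulr_ge0 ?exprn_ge0 ?ler0n // ltW.
(* The added 1 is the missing term [j = 0], which completes a partial sum of the exponential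
   series. *)
rewrite lerBrDr; apply: le_trans (expR_partial_sum #|A|.+1 (ltW t0)).
by rewrite !big_mkcond !big_ord_recl /= expr0 fact0 divr1 add0r addrC.
Qed.

End Onto.

(** Disjoint sources make the conditions independent, so the bounds of [pr_onto] multiply. *)
Lemma pr_blocks (R : realType) (Y X : finType) (t : R) (bl : seq ({set Y} * {set X})) :
  0 < t -> pairwise (fun A B : {set Y} => [disjoint A & B]) (unzip1 bl) ->
  @pr R Y X (fun f => all (fun ab : {set Y} * {set X} => f @: ab.1 == ab.2) bl) <=
  \prod_(ab <- bl) ((expR t - 1) ^+ #|ab.2| * (#|ab.1| `!%:R / (t * #|X|%:R) ^+ #|ab.1|)).
Proof.
move=> t0; elim: bl => [|[A B] bl IH] /=; first by rewrite big_nil pr_le1.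
case/andP => /allP dA /IH {}IH; rewrite big_cons /=.
pose P : pred {ffun Y -> X} := fun f => f @: A == B.
pose Q : pred {ffun Y -> X} :=
  fun f => all (fun ab : {set Y} * {set X} => f @: ab.1 == ab.2) bl.
rewrite (_ : pr _ _ = @pr R Y X (predI P Q)) //.
rewrite (@pr_indep _ _ _ A); first last.
- move=> f g fg; apply: eq_in_all => ab abbl; congr (_ == _).
  apply: eq_in_imset => y yab; apply: fg; rewrite inE.
  have /pred0P/(_ y) /= dab := dA _ (map_f fst abbl).
  by apply/negP => yA; rewrite yA yab in dab.
- by move=> f g fg; congr (_ == _); apply: eq_in_imset.
by apply: ler_pM; rewrite ?pr_ge0 //; apply: le_trans (pr_onto _ _ t0) _; rewrite mulrA.
Qed.

(** * Cyclic image conditions *)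

Section Cyclic.
Variables (R : realType) (X S : finType).
Implicit Types P : seq {set X}.

(** The list [[:: C]] pairs [C] with itself, so closed classes and periodic ones are treated by the
    same bound. *)
Definition cyclic_blocks P : seq ({set X * S} * {set X}) :=
  zip [seq finset.setX T [set: S] | T <- P] (rot 1 P).

Definition cyclic_event P (f : {ffun X * S -> X}) :=
  all (fun ab : {set X * S} * {set X} => f @: ab.1 == ab.2) (cyclic_blocks P).

(** Rotation preserves the total size, so only the factorials depend on how the states are divided
    into parts. *)
Lemma pr_cyclic (t : R) P : 0 < t -> pairwise (fun A B : {set X} => [disjoint A & B]) P ->
  pr R (cyclic_event P) <=
  (expR t - 1) ^+ (\sum_(T <- P) #|T|) / (t * #|X|%:R) ^+ ((\sum_(T <- P) #|T|) * #|S|)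
  * \prod_(T <- P) ((#|T| * #|S|)`!)%:R.
Proof.
move=> t0 dP.
have sz : size [seq finset.setX T [set: S] | T <- P] = size (rot 1 P).
  by rewrite size_map size_rot.
apply: le_trans (pr_blocks t0 _) _.
  rewrite unzip1_zip ?sz // pairwise_map; apply: sub_pairwise dP => A B /pred0P dAB.
  apply/pred0P => -[x s] /=; rewrite !inE /= !andbT; exact: dAB.
rewrite big_split /= -(big_map snd xpredT (fun B : {set X} => (expR t - 1) ^+ #|B|)).
rewrite -/(unzip2 _) unzip2_zip ?sz // (perm_big P) ?perm_rot //= prodrXr.
rewrite -(big_map fst xpredT (fun A : {set X * S} => #|A| `!%:R / (t * #|X|%:R) ^+ #|A|)).
rewrite -/(unzip1 _) unzip1_zip ?sz // big_map.
under [X in _ * X <= _]eq_bigr do rewrite cardsX cardsT.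
by rewrite big_split /= prodfV prodrXr big_distrl /= mulrA mulrAC.
Qed.
End Cyclic.

(** * Ordered partitions *)

Lemma leq_bin_self n j : (0 < j < n)%N -> (n <= 'C(n, j))%N.
Proof.
elim: n j => [|n IH] [|j] //= jn; rewrite binS.
have [jn'|nj] := ltnP j.+1 n.
  rewrite -addn1; apply: leq_add; first exact: IH.
  by rewrite bin_gt0; lia.
have -> : n = j.+1 by lia.
by rewrite binn binSn.
Qed.

Lemma leq_bin_add a b a' b' : (a <= a')%N -> (b <= b')%N -> ('C(a + b, a) <= 'C(a' + b', a'))%N.
Proof.
move=> aa bb; apply: (@leq_trans 'C(a + b', a)).
  by apply: leq_bin2l; rewrite leq_add2l.
have e x : 'C(x + b', x) = 'C(x + b', b').
  by rewrite -(bin_sub (leq_addl x b')) addnK.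
by rewrite !e; apply: leq_bin2l; rewrite leq_add2r.
Qed.

Lemma bin_mul_mono a b q : (0 < q)%N -> ('C(a + b, a) <= 'C((a + b) * q, a * q))%N.
Proof. by move=> q0; rewrite mulnDl; apply: leq_bin_add; rewrite leq_pmulr. Qed.

(** Keeps a single term of the Vandermonde sum. *)
Lemma bin_mul_split m a q : (a <= m)%N ->
  ('C(m, a) * 'C(m * q, a * q) <= 'C(m * q.+1, a * q.+1))%N.
Proof.
move=> am; rewrite [(m * q.+1)%N]mulnS -binomial.Vandermonde.
have aS : (a < (a * q.+1).+1)%N by rewrite ltnS leq_pmulr.
have e : (a * q.+1 - a = a * q)%N by rewrite mulnS addKn.
by rewrite (bigD1 (Ordinal aS)) //= e; apply: leq_addr.
Qed.

(** The ratio of factorials is [C(m r, a r)]. In its lower bound the factor [C(m, a)] pays for the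
    choice of an [a]-subset; the other binomial is the gain from splitting. *)
Lemma fact_mul_split m a r : (1 < r)%N -> (a <= m)%N ->
  ('C(m, a) * ((a * r)`! * ((m - a) * r)`!) * 'C(m * r.-1, a * r.-1) <= (m * r)`!)%N.
Proof.
move=> r1 am; have arm : (a * r <= m * r)%N by rewrite leq_mul2r am orbT.
rewrite -(bin_fact arm) mulnAC mulnBl leq_mul2r; apply/orP; right.
by have := bin_mul_split r.-1 am; rewrite prednK // ltnW.
Qed.

(* With [m = a + b] and [a, b >= 6], one of [a, b] is at least [m / 2]. *)
Lemma bin_middle_lb a b : (6 <= a)%N -> (6 <= b)%N ->
  ((a + b) ^ 6 <= 2 ^ 6 * 6`! * 'C(a + b, a))%N.
Proof.
wlog ab : a b / (a <= b)%N => [H a6 b6|a6 b6].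
  have [/H|/ltnW /H] := leqP a b; first by apply.
  by rewrite addnC => /(_ b6 a6); rewrite -(bin_sub (leq_addl a b)) addnK.
apply: (@leq_trans (2 ^ 6 * 6`! * 'C(6 + b, 6))); last by rewrite leq_mul2l leq_bin_add ?orbT.
rewrite -mulnA [(6`! * _)%N]mulnC bin_ffact.
apply: (@leq_trans (2 ^ 6 * b.+1 ^ 6)).
  by rewrite -expnMn leq_exp2r //; lia.
rewrite leq_mul2l; apply/orP; right.
rewrite !ffactnS ffactn0 muln1 !expnS expn0 muln1.
by do !(apply: leq_mul); lia.
Qed.

Section OrderedPartitions.
Variables (R : realType) (X : finType) (r : nat).
Hypothesis r1 : (1 < r)%N.
Implicit Types (S T U C : {set X}) (P : seq {set X}).

(* [N] is fuel: it bounds the number of parts. *)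
Fixpoint ordered_partitions N S : seq (seq {set X}) :=
  if S == set0 then [:: [::]] else
  if N is N'.+1 then
    [seq T :: P | T <- enum (powerset S :\ set0), P <- ordered_partitions N' (S :\: T)]
  else [::].

Definition disjoint_parts P := pairwise (fun A B : {set X} => [disjoint A & B]) P.

Lemma mem_ordered_partitions N P S : (size P <= N)%N -> all (fun T => T != set0) P ->
  disjoint_parts P -> \bigcup_(T <- P) T = S -> P \in ordered_partitions N S.
Proof.
elim: N P S => [|N IH] [|T P] S //=; rewrite ?big_nil ?big_cons.
- by move=> _ _ _ <-; rewrite eqxx mem_head.
- by move=> _ _ _ <-; rewrite eqxx mem_head.
move=> szP /andP[T0 P0] /andP[/allP dT dP] <-.
rewrite setU_eq0 (negbTE T0) /=; apply/allpairsPdep; exists T, P; split=> //.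
  by rewrite mem_enum !inE T0 finset.subsetUl.
apply: IH => //; rewrite setDUl finset.setDv finset.set0U; apply/esym/setDidPl.
rewrite disjoint_sym; apply/pred0P => x /=.
apply/negP => /andP[xT]; rewrite bigcup_seq => /bigcupP[A /dT /pred0P/(_ x) /= + xA].
by rewrite xT xA.
Qed.

Definition weight P : R := \prod_(T <- P) ((#|T| * r)`!)%:R.

Lemma weight_ge0 P : 0 <= weight P.
Proof. by apply: prodr_ge0 => T _; apply: ler0n. Qed.

Lemma sum_nat_pos_const m (W : pred nat) (c : R) : ~~ W 0%N -> 0 <= c ->
  \sum_(j < m.+1 | W j) c <= m%:R * c.
Proof.
move=> W0 c0; rewrite big_mkcond big_ord_recl /= (negbTE W0) add0r.
apply: (@le_trans _ _ (\sum_(j < m) c)); last by rewrite sumr_const card_ord mulr_natl.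
by apply: ler_sum => j _; case: ifP.
Qed.

(** Induction on the first block, of size [j]. For [0 < j < m], the gain [C(m (r - 1), j (r - 1))]
    of [fact_mul_split] is at least [m] and absorbs the factor of the induction hypothesis, so each
    of the [m] sizes contributes at most [(m r)!]. The [maxn 1] is for the empty set, whose only
    partition has weight 1. *)
Lemma sum_weight_ordered_partitions N S :
  \sum_(P <- ordered_partitions N S) weight P <= (maxn 1 #|S|)%:R * ((#|S| * r)`!)%:R.
Proof.
elim: N S => [|N IH] S /=; case: eqP => [->|/eqP S0].
- by rewrite big_seq1 /weight big_nil cards0 mul0n fact0 mulr1.
- by rewrite big_nil mulr_ge0 ?ler0n.
- by rewrite big_seq1 /weight big_nil cards0 mul0n fact0 mulr1.
rewrite big_allpairs_dep big_enum /=; set m := #|S|.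
have m0 : (0 < m)%N by rewrite card_gt0.
pose G j : R := ((j * r)`! * (maxn 1 (m - j) * ((m - j) * r)`!))%:R.
apply: (@le_trans _ _ (\sum_(T : {set X} | (T \subset S) && (0 < #|T|)%N) G #|T|)).
  rewrite [leRHS](eq_bigl (mem (powerset S :\ set0))); last first.
    by move=> T; rewrite !inE card_gt0 andbC.
  apply: ler_sum => T; rewrite !inE => /andP[T0 TS].
  rewrite /weight; under eq_bigr do rewrite big_cons.
  rewrite -mulr_sumr /G natrM; apply: ler_wpM2l; first exact: ler0n.
  by apply: le_trans (IH _) _; rewrite cardsD (finset.setIidPr TS) natrM.
rewrite sum_subsets_card -/m.
apply: (@le_trans _ _ (\sum_(j < m.+1 | (0 < j)%N) ((m * r)`!)%:R)); last first.
  apply: le_trans (@sum_nat_pos_const _ (fun j => 0 < j)%N _ _ _) _ => //.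
  by rewrite (maxn_idPr m0).
apply: ler_sum => j j0; have jm : (j <= m)%N by rewrite -ltnS.
rewrite /G -mulrnA ler_nat.
move: jm; rewrite leq_eqVlt => /orP[/eqP ->|jm].
  by rewrite subnn maxn0 mul0n fact0 binn !muln1.
have := fact_mul_split r1 (ltnW jm); apply: leq_trans.
have mC : (maxn 1 (m - j) <= 'C(m * r.-1, j * r.-1))%N.
  apply: leq_trans (leq_bin_self _); last by rewrite ltn_mul2r muln_gt0 j0; lia.
  by apply: (@leq_trans m); [lia|rewrite leq_pmulr //; lia].
set b := (j * r)`!; set c := ((m - j) * r)`!; set M := maxn _ _ in mC *.
rewrite [leqLHS](_ : _ = ('C(m, j) * (b * c)) * M)%N; last by ring.
by rewrite leq_mul2l mC orbT.
Qed.

(** Here six powers of [m] must be absorbed: three are stated, two come from the sums over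
    partitions of [U] and of its complement, one from the number of sizes of [U]. A cut with at
    least 6 states on each side provides them, by [bin_middle_lb]. *)
Lemma sum_weight_cut N C :
  #|C|%:R ^+ 3 * \sum_(U : {set X} | (U \subset C) && ((5 < #|U|) && (#|U| + 5 < #|C|))%N)
    ((\sum_(P <- ordered_partitions N U) weight P) *
     (\sum_(P <- ordered_partitions N (C :\: U)) weight P))
  <= (2 ^ 6 * 6`!)%:R * ((#|C| * r)`!)%:R.
Proof.
set m := #|C|; set K := (2 ^ 6 * 6`!)%N.
pose G j : R := (m ^ 2 * ((j * r)`! * ((m - j) * r)`!))%:R.
pose W j := ((5 < j) && (j + 5 < m))%N.
have [m0|m0] := posnP m.
  by rewrite m0 expr0n mul0r mulr_ge0 ?ler0n.
apply: (@le_trans _ _ (m%:R ^+ 3 *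
    (\sum_(U : {set X} | (U \subset C) && W #|U|) G #|U|))).
  apply: ler_wpM2l; first by rewrite exprn_ge0 ?ler0n.
  apply: ler_sum => U /andP[UC /andP[U5 UC5]].
  apply: le_trans (ler_pM _ _ (sum_weight_ordered_partitions N U)
    (sum_weight_ordered_partitions N (C :\: U))) _.
  - by apply: sumr_ge0 => P _; apply: weight_ge0.
  - by apply: sumr_ge0 => P _; apply: weight_ge0.
  rewrite cardsD (finset.setIidPr UC) -/m mulrACA -!natrM ler_nat.
  rewrite leq_mul2r; apply/orP; right; rewrite -mulnn; apply: leq_mul; lia.
rewrite sum_subsets_card -/m mulr_sumr.
apply: (@le_trans _ _ (\sum_(j < m.+1 | W j) (K%:R * ((m * r)`!)%:R / m%:R))); last first.
  apply: le_trans (@sum_nat_pos_const _ W _ _ _) _ => //.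
  by rewrite mulrC divfK // pnatr_eq0 -lt0n.
apply: ler_sum => j /andP[j5 jm5]; rewrite ler_pdivlMr ?ltr0n //.
rewrite /G -mulrnA -!natrX -!natrM ler_nat.
have jm : (j <= m)%N by lia.
apply: (@leq_trans (K * ('C(m, j) * ((j * r)`! * ((m - j) * r)`!) * 'C(m * r.-1, j * r.-1)))%N);
  last by rewrite leq_mul2l fact_mul_split ?orbT.
have mC : (m ^ 6 <= K * 'C(m * r.-1, j * r.-1))%N.
  have e : (j + (m - j) = m)%N by rewrite subnKC.
  have := @bin_middle_lb j (m - j); rewrite e => /(_ j5) H.
  apply: leq_trans (H _) _; first by lia.
  rewrite leq_mul2l; apply/orP; right.
  by have := @bin_mul_mono j (m - j) r.-1; rewrite e; apply; lia.
set a := 'C(m, j); set b := (_ * _)`!; set c := (_ * _)`!; set d := 'C(_, _) in mC *.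
rewrite [leqLHS](_ : _ = (a * (b * c)) * m ^ 6)%N; last by ring.
rewrite [leqRHS](_ : _ = (a * (b * c)) * (K * d))%N; last by ring.
by rewrite leq_mul2l mC orbT.
Qed.

End OrderedPartitions.

(** * Closed communicating classes *)

Lemma card_bigcup_disjoint (X : finType) (P : seq {set X}) : disjoint_parts P ->
  #|\bigcup_(T <- P) T| = (\sum_(T <- P) #|T|)%N.
Proof.
elim: P => [|T P IH] /=; first by rewrite !big_nil cards0.
move=> /andP[/allP dT /IH {}IH]; rewrite !big_cons cardsU IH disjoint_setI0 ?cards0 ?subn0 //.
apply/pred0P => x /=; apply/negP => /andP[xT].
rewrite bigcup_seq => /bigcupP[A /dT /pred0P/(_ x) /= + xA].
by rewrite xT xA.
Qed.

Section Automaton.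
Variables (n r : nat) (tau : {ffun 'I_n * 'I_r -> 'I_n}).
Implicit Types (p q : 'I_n) (C : {set 'I_n}).

Lemma run_cat p x y : run tau p (x ++ y) = run tau (run tau p x) y.
Proof. by rewrite /run foldl_cat. Qed.

Lemma reachable_refl p : reachable tau p p.
Proof. by exists [::]. Qed.

Lemma reachable_trans p q s : reachable tau p q -> reachable tau q s -> reachable tau p s.
Proof. by move=> [x <-] [y <-]; exists (x ++ y); rewrite run_cat. Qed.

Lemma reachable_step p s : reachable tau p (tau (p, s)).
Proof. by exists [:: s]. Qed.

Lemma closed_comm_class_n0 C : closed_comm_class tau C -> C != set0.
Proof.
move=> [[q qC] _]; apply/set0Pn; exists q; apply/qC.
by split; apply: reachable_refl.
Qed.

Lemma closed_comm_class_reach C p q : closed_comm_class tau C -> p \in C ->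
  (q \in C) <-> reachable tau p q.
Proof.
move=> [[q0 qC] CS] pC; split.
  move=> /qC[q0q _]; have [_ pq0] := (qC p).1 pC; exact: reachable_trans pq0 q0q.
by move=> [x xq]; apply/CS; exists p, x.
Qed.

Lemma closed_comm_class_eq C C' p : closed_comm_class tau C -> closed_comm_class tau C' ->
  p \in C -> p \in C' -> C' = C.
Proof.
move=> hC hC' pC pC'; apply/setP => q; apply/idP/idP.
  by move/(closed_comm_class_reach q hC' pC')/(closed_comm_class_reach q hC pC).
by move/(closed_comm_class_reach q hC pC)/(closed_comm_class_reach q hC' pC').
Qed.

(** Each [q] in [C] is reached from its successor [tau (q, s)], and the last step of such a path
    gives a preimage in [C]. *)
Lemma closed_comm_class_onto C : (0 < r)%N -> closed_comm_class tau C ->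
  cyclic_event [:: C] tau.
Proof.
move=> r0 hC; rewrite /cyclic_event /= andbT; apply/eqP/setP => q; apply/imsetP/idP.
  case=> -[p s]; rewrite !inE /= => /andP[pC _] ->.
  by apply/(closed_comm_class_reach _ hC pC); apply: reachable_step.
move=> qC; pose s := Ordinal r0.
have tC : tau (q, s) \in C.
  by apply/(closed_comm_class_reach _ hC qC); apply: reachable_step.
have [x] := (closed_comm_class_reach q hC tC).1 qC.
(* If the path is empty then [tau (q, s) = q], and [q] is its own preimage. *)
case/lastP: x => [|x s'] xq; first by exists (q, s); [rewrite !inE /= qC | exact: esym xq].
exists (run tau (tau (q, s)) x, s'); last by rewrite -[LHS]xq -cats1 run_cat.
by rewrite !inE /= andbT; apply/(closed_comm_class_reach _ hC tC); exists x.
Qed.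

(** Take [q] with the fewest reachable states. A state reachable from [q] reaches no fewer, hence
    exactly the same ones, including [q]. *)
Lemma closed_comm_class_exists : (0 < n)%N -> exists C, closed_comm_class tau C.
Proof.
move=> n0; pose reach q : {set 'I_n} := [set p | `[< reachable tau q p >]].
have reachE q p : (p \in reach q) <-> reachable tau q p.
  by rewrite inE; split => [/asboolP|h] //; apply/asboolP.
case: (arg_minnP (fun q => #|reach q|) (i0 := Ordinal n0) (P := xpredT) isT) => q _ qmin.
have back p : reachable tau q p -> reachable tau p q.
  move=> qp; have sub : reach p \subset reach q.
    by apply/fintype.subsetP => s /reachE ps; apply/reachE; apply: reachable_trans ps.
  have /eqP e : reach p == reach q by rewrite eqEcard sub qmin.
  by apply/reachE; rewrite e; apply/reachE; apply: reachable_refl.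
exists (reach q); split.
  exists q => p; split => [/reachE qp|[qp _]]; last exact/reachE.
  by split => //; apply: back.
move=> q'; split => [[p [x [/reachE qp px]]]|qq'].
  by apply/reachE; apply: reachable_trans qp _; exists x.
by exists q', [::].
Qed.

Lemma periodic_parts C k : k_periodic tau C k ->
  exists P : 'I_k -> {set 'I_n},
   [/\ (1 < k)%N, forall i, P i != set0, forall i j, i != j -> [disjoint P i & P j],
     \bigcup_(T <- [seq P i | i <- enum 'I_k]) T = C &
     forall i, tau @: finset.setX (P i) [set: 'I_r] = P (ordS i)].
Proof.
move=> [k1 [P [P0 [dP [PC Pnext]]]]]; exists P; split=> //.
  by rewrite big_map big_enum.
move=> i; apply/setP => q; apply/imsetP/idP.
  by case=> -[p s]; rewrite !inE /= andbT => pP ->; apply/Pnext; exists p, s.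
by move/Pnext => [p [s [pP <-]]]; exists (p, s); rewrite // !inE /= pP.
Qed.

(** Reconciles the rotation in [cyclic_blocks] with the successor modulo [k] in the definition of
    periodicity. *)
Lemma rot1_enum_ord k : rot 1 (enum 'I_k) = [seq ordS i | i <- enum 'I_k].
Proof.
case: k => [|k]; first by rewrite (size0nil (size_enum_ord 0)).
rewrite {1}enum_ordSl rot1_cons enum_ordSr map_rcons -!map_comp.
congr rcons; last by apply: val_inj; rewrite /= modnn.
apply: eq_map => i; apply: val_inj.
by rewrite /= /bump /= add1n modn_small // ltnS.
Qed.

Lemma disjoint_parts_map k (P : 'I_k -> {set 'I_n}) (s : seq 'I_k) : uniq s ->
  (forall i j, i != j -> [disjoint P i & P j]) -> disjoint_parts [seq P i | i <- s].
Proof.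
move=> us dP; rewrite /disjoint_parts pairwise_map.
by move: us; rewrite uniq_pairwise; apply: sub_pairwise => i j; apply: dP.
Qed.

(** [U] is the shortest prefix with at least 6 states. Before its last part [P i] it has at most 5.
    If at most 5 states of [C] were left outside [U], then [P i] would miss at most 10 states of
    [C], so its predecessor would have at most 10 states and [P i] at most [10 r], whence
    [#|C| <= 10 (r + 1)]. *)
Lemma periodic_cut C k : (10 * r.+1 < #|C|)%N -> k_periodic tau C k ->
  exists (U : {set 'I_n}) P1 P2, [/\ U \subset C, ((5 < #|U|) && (#|U| + 5 < #|C|))%N,
    P1 \in ordered_partitions n U, P2 \in ordered_partitions n (C :\: U) &
    [&& disjoint_parts (P1 ++ P2), (\sum_(T <- P1 ++ P2) #|T|)%N == #|C| &
      cyclic_event (P1 ++ P2) tau]].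
Proof.
move=> Cbig /periodic_parts[P [k1 P0 dP PC Pnext]].
set l := [seq P i | i <- enum 'I_k] in PC.
have szl : size l = k by rewrite size_map size_enum_ord.
have dl : disjoint_parts l by apply: disjoint_parts_map => //; apply: enum_uniq.
have cardC : #|C| = (\sum_(T <- l) #|T|)%N by rewrite -PC card_bigcup_disjoint.
have l0 : all (fun T => T != set0) l by apply/allP => T /mapP[i _ ->].
(* The parts are nonempty and disjoint, so fuel [n] is enough for [ordered_partitions]. *)
have kn : (k <= n)%N.
  rewrite -szl -[n in (_ <= n)%N]card_ord; apply: leq_trans (max_card C).
  rewrite cardC -sum1_size big_seq [leqRHS]big_seq; apply: leq_sum => T /(allP l0).
  by rewrite card_gt0.
pose s j := (\sum_(T <- take j l) #|T|)%N.
have ex : exists j, (5 < s j)%N by exists k; rewrite /s take_oversize ?szl // -cardC; lia.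
case: (ex_minnP ex) => -[|j]; first by rewrite /s take0 big_nil.
move=> sj smin; have sj' : (s j <= 5)%N by rewrite leqNgt; apply/negP => /smin; rewrite ltnn.
have jk : (j < k)%N.
  rewrite ltnNge; apply/negP => kj; move: sj.
  by rewrite /s take_oversize ?szl ?(leq_trans kj) // -[l](@take_oversize _ j) ?szl // ltnNge sj'.
(* The predecessor is cyclic: for [j = 0] it is the last part. It differs from [i] because
   [1 < k]. *)
pose i := Ordinal jk; pose i' := ord_pred i.
have sS : s j.+1 = (s j + #|P i|)%N.
  rewrite /s (take_nth set0) ?szl // -cats1 big_cat big_seq1 /=; congr (_ + #|_|)%N.
  rewrite (nth_map i) ?size_enum_ord //.
  by have -> : nth i (enum 'I_k) j = i by exact: (nth_ord_enum i i).
have ii' : ordS i' = i by apply: ord_predK.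
have nii' : i' != i.
  apply/eqP => e; move: ii'; rewrite e => /(congr1 val) /=.
  have [jk1|jk1] := eqVneq j.+1 k; first by rewrite jk1 modnn; lia.
  by rewrite modn_small; lia.
have Pi : (#|P i| <= #|P i'| * r)%N.
  rewrite -[in X in (X <= _)%N]ii' -Pnext; apply: leq_trans (leq_imset_card _ _) _.
  by rewrite cardsX cardsT card_ord.
have PiC : (#|P i| + #|P i'| <= #|C|)%N.
  rewrite -[(_ + _)%N]subn0 -(cards0 'I_n) -(disjoint_setI0 (dP _ _ nii')) finset.setIC -cardsU.
  apply: subset_leq_card; rewrite finset.subUset -PC big_map big_enum /=.
  by apply/andP; split; apply: finset.bigcup_sup.
have sC : (s j.+1 + 5 < #|C|)%N.
  rewrite sS ltnNge; apply/negP => h; have i10 : (#|P i'| <= 10)%N by lia.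
  have : (#|P i'| * r <= 10 * r)%N by rewrite leq_mul2r i10 orbT.
  by lia.
exists (\bigcup_(T <- take j.+1 l) T), (take j.+1 l), (drop j.+1 l).
have [dtd' dt dd] : [/\ allrel (fun A B : {set 'I_n} => [disjoint A & B])
    (take j.+1 l) (drop j.+1 l), disjoint_parts (take j.+1 l) & disjoint_parts (drop j.+1 l)].
  by apply/and3P; rewrite -pairwise_cat cat_take_drop.
have UE : #|\bigcup_(T <- take j.+1 l) T| = s j.+1 by rewrite card_bigcup_disjoint.
have CE : C = (\bigcup_(T <- take j.+1 l) T) :|: (\bigcup_(T <- drop j.+1 l) T).
  by rewrite -PC -[in LHS](cat_take_drop j.+1 l) big_cat.
have allt := l0; rewrite -(cat_take_drop j.+1 l) all_cat in allt.
case/andP: allt => allt alld.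
split.
- by rewrite CE finset.subsetUl.
- by rewrite UE sj.
- by apply: mem_ordered_partitions allt dt (erefl _); rewrite size_take szl; case: ifP; lia.
- apply: mem_ordered_partitions alld dd _; first by rewrite size_drop szl; lia.
  rewrite CE setDUl finset.setDv finset.set0U; apply/esym/setDidPl.
  apply/pred0P => x /=; rewrite !bigcup_seq; apply/negP.
  move=> /andP[/bigcupP[A Ad xA] /bigcupP[B Bt xB]].
  by have /allrelP/(_ _ _ Bt Ad)/pred0P/(_ x) /= := dtd'; rewrite xA xB.
rewrite cat_take_drop cardC eqxx dl /= /cyclic_event /cyclic_blocks -map_comp.
rewrite -map_rot rot1_enum_ord -map_comp zip_map all_map; apply/allP => i0 _ /=.
by rewrite Pnext.
Qed.

End Automaton.

(** * First-moment estimates *)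

Section RealBounds.
Variable R : realType.
Implicit Types (x y p q d : R).

Lemma binomial_term_le n m p q : 0 <= p -> 0 <= q -> (m <= n)%N ->
  'C(n, m)%:R * p ^+ m * q ^+ (n - m) <= (p + q) ^+ n.
Proof.
move=> p0 q0 mn; rewrite addrC exprDn.
rewrite (bigD1 (Ordinal (mn : (m < n.+1)%N))) //=.
have -> : q ^+ (n - m) * p ^+ m *+ 'C(n, m) = 'C(n, m)%:R * p ^+ m * q ^+ (n - m).
  by rewrite -mulr_natl; ring.
rewrite lerDl; apply: sumr_ge0 => i _.
by rewrite mulrn_wge0 // mulr_ge0 ?exprn_ge0.
Qed.

(** Square of the tangent bound at [x / 2]. *)
Lemma expR_ge_quad x : 0 <= x -> 1 + x + x ^+ 2 / 4 <= expR x.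
Proof.
move=> x0; have e : expR x = expR (x / 2) ^+ 2 by rewrite -expRM_natl; congr expR; field.
rewrite e; have h := expR_ge1Dx (x / 2); nra.
Qed.

(** From [e^(-x) >= 1 - x], since [(1 + x + 2 x^2) (1 - x) = 1 + x^2 (1 - 2 x)]. Negative [x] is
    allowed, as the Chernoff tilt below may have either sign. *)
Lemma expR_le_quad x : x <= 2^-1 -> expR x <= 1 + x + 2 * x ^+ 2.
Proof.
move=> x1; have h := expR_ge1Dx (- x).
have E : expR x * expR (- x) = 1 by rewrite -expRD subrr expR0.
have e0 := expR_gt0 x; have : expR x * (1 - x) <= 1 by nra.
move=> H; suff : (1 + x + 2 * x ^+ 2) * (1 - x) >= 1 by nra.
nra.
Qed.

(* Stirling up to a factor [n]: passing from [n] to [n + 1] multiplies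
   [n! (e/n)^n] by [e (n/(n+1))^n <= (n+1)/n]. *)
Lemma fact_expR_le n : (0 < n)%N -> n`!%:R * expR n%:R <= expR 1 * n%:R * n%:R ^+ n :> R.
Proof.
elim: n => // n IH _; have [->|n0] := posnP n.
  by rewrite factS fact0 expr1 !mulr1 mul1r.
have nR : 0 < n.+1%:R :> R by rewrite ltr0n.
have step : expR 1 * n%:R ^+ n.+1 <= n.+1%:R ^+ n.+1 :> R.
  have h : (n%:R / n.+1%:R) ^+ n.+1 <= expR (- 1) :> R.
    rewrite (_ : - 1 = n.+1%:R * (- n.+1%:R^-1)) ?expRM_natl; last first.
      by rewrite mulrN mulfV // gt_eqF.
    rewrite lerXn2r ?nnegrE ?divr_ge0 ?ler0n ?expR_ge0 //.
    apply: le_trans (expR_ge1Dx _); rewrite -addn1 natrD.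
    by rewrite le_eqVlt; apply/orP; left; apply/eqP; field; rewrite -natr1 in nR; rewrite gt_eqF.
  rewrite expr_div_n ler_pdivrMr ?exprn_gt0 // expRN in h.
  by rewrite -ler_pdivlMl ?expR_gt0.
rewrite factS natrM -[in expR _]natr1 expRD.
have -> : n.+1%:R * n`!%:R * (expR n%:R * expR 1) =
  n.+1%:R * expR 1 * (n`!%:R * expR n%:R) :> R by ring.
apply: le_trans (ler_wpM2l _ (IH n0)) _; first by rewrite mulr_ge0 ?expR_ge0 ?ler0n.
have -> : n.+1%:R * expR 1 * (expR 1 * n%:R * n%:R ^+ n) =
  expR 1 * n.+1%:R * (expR 1 * n%:R ^+ n.+1) :> R by rewrite exprS; ring.
by rewrite ler_wpM2l // mulr_ge0 ?expR_ge0 ?ler0n.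
Qed.

End RealBounds.

(** * The fixed point of [x = 1 - exp (- r x)] *)

Section Constant.
Variables (R : realType) (r : nat) (c : R).
Hypotheses (r2 : (2 <= r)%N) (c0 : 0 < c) (cE : c = 1 - expR (- (c * r%:R))).

Let rR : 2 <= r%:R :> R. Proof. by rewrite (ler_nat _ 2). Qed.

(** The left side is the derivative of [1 - exp (- r x)] at [c]. With [y = c r], the equation reads
    [e^y (1 - c) = 1], and [e^y > 1 + y] gives [c r (1 - c) < c]. *)
Lemma fixpoint_derivative_lt1 : r%:R * (1 - c) < 1.
Proof.
have e : 1 - c = expR (- (c * r%:R)) by rewrite [in LHS]cE; ring.
have y0 : 0 < c * r%:R by rewrite mulr_gt0 // (lt_le_trans _ rR).
have hy := expR_ge_quad (ltW y0).
have E : expR (c * r%:R) * (1 - c) = 1 by rewrite e -expRD subrr expR0.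
have v0 : 0 < 1 - c by rewrite e expR_gt0.
have : (1 + c * r%:R + (c * r%:R) ^+ 2 / 4) * (1 - c) <= 1 by rewrite -[leRHS]E ler_pM2r.
have : 0 < (c * r%:R) ^+ 2 by rewrite exprn_gt0.
move=> y2 h.
suff : c * (r%:R * (1 - c)) < c * 1 by rewrite ltr_pM2l.
nra.
Qed.

Lemma fixpoint_lt1 : c < 1.
Proof. by rewrite cE gtrBl expR_gt0. Qed.

Lemma fixpoint_gt_half : 2^-1 < c.
Proof.
have := fixpoint_derivative_lt1; have := fixpoint_lt1; have := rR; nra.
Qed.

(* Tangent lines of the convex function [x |-> exp (- r x)] at [x], evaluated at [0]
   (to second order) and at [c], give the bound for [x < c]. *)
Lemma fixpoint_gap_lb (delta : R) : 0 < delta ->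
  exists2 a, 0 < a & forall x, delta <= x -> x <= 1 ->
    a * `|x - c| <= `|x - (1 - expR (- (r%:R * x)))|.
Proof.
move=> delta0; set rr := r%:R : R; have rr2 : 2 <= rr by exact: rR.
pose a1 := expR (- rr) * delta ^+ 2 / 4.
pose a2 := 1 - rr * (1 - c).
have a10 : 0 < a1 by rewrite divr_gt0 ?mulr_gt0 ?expR_gt0 ?exprn_gt0.
have a20 : 0 < a2 by rewrite subr_gt0 fixpoint_derivative_lt1.
exists (Num.min a1 a2); first by rewrite lt_min a10 a20.
move=> x dx x1; have [xc|cx] := leP x c.
  have e1 : expR (- (rr * x)) * expR (rr * x) = 1 by rewrite -expRD addNr expR0.
  have e2 : expR (- (rr * x)) * expR (- (rr * (c - x))) = 1 - c.
    rewrite -expRD [in RHS]cE opprD addrA subrr add0r opprK; congr expR; rewrite -/rr; ring.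
  have x0 : 0 < x by exact: lt_le_trans dx.
  have q := expR_ge_quad (_ : 0 <= rr * x).
  have {q} q : 1 + rr * x + (rr * x) ^+ 2 / 4 <= expR (rr * x) by apply: q; nra.
  have l := expR_ge1Dx (- (rr * (c - x))).
  have v0 := expR_gt0 (- (rr * x)).
  have vr : expR (- rr) <= expR (- (rr * x)) by rewrite ler_expR; nra.
  set v := expR (- (rr * x)) in e1 e2 v0 vr *.
  have h1 : v * (1 + rr * x + (rr * x) ^+ 2 / 4) <= 1 by rewrite -[leRHS]e1 ler_pM2l.
  have h2 : v * (1 - rr * (c - x)) <= 1 - c by rewrite -[leRHS]e2 ler_pM2l.
  (* Weights [c - x] on [h1] and [x] on [h2] cancel the terms in [rr * x * (c - x)]; the quadratic
     term survives and is bounded below by [a1]. *)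
  have h3 : c * v + (c - x) * (v * ((rr * x) ^+ 2 / 4)) <= c * (1 - x).
    have := ler_wpM2l (ltW x0) h2; have cx0 : 0 <= c - x by rewrite subr_ge0.
    have := ler_wpM2l cx0 h1; lra.
  have h4 : a1 <= v * ((rr * x) ^+ 2 / 4).
    rewrite /a1 -mulrA; apply: ler_pM => //; rewrite ?expR_ge0 //.
      by rewrite divr_ge0 ?exprn_ge0 // ltW.
    rewrite ler_pM2r ?invr_gt0 ?ltr0n // lerXn2r ?nnegrE ?(ltW delta0) //; nra.
  have c1 := fixpoint_lt1.
  have h5 : a1 * (c - x) <= 1 - x - v.
    have cx0 : 0 <= c - x by rewrite subr_ge0.
    have : (c - x) * a1 <= (c - x) * (v * ((rr * x) ^+ 2 / 4)) by exact: ler_wpM2l.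
    move=> h; have h6 : (c - x) * a1 <= c * (1 - x - v) by lra.
    have p0 : 0 <= (c - x) * a1 by rewrite mulr_ge0 // ltW.
    have : 0 <= 1 - x - v by rewrite -(pmulr_rge0 _ c0); apply: le_trans h6.
    by move=> w0; apply: (@le_trans _ _ (c * (1 - x - v))); [rewrite mulrC|nra].
  rewrite [leLHS](_ : _ = Num.min a1 a2 * (c - x)); last by rewrite ler0_norm ?subr_le0 // opprB.
  apply: (@le_trans _ _ (a1 * (c - x))); first by rewrite ler_wpM2r ?subr_ge0 // ge_min lexx.
  by apply: le_trans h5 _; rewrite -normrN; apply: le_trans (ler_norm _); lra.
(* For [x > c] the tangent at [c] alone suffices: the difference grows at least with slope
   [a2 = 1 - r (1 - c)]. *)
have e : expR (- (rr * x)) = (1 - c) * expR (- (rr * (x - c))).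
  have -> : 1 - c = expR (- (c * rr)) by rewrite [in LHS]cE -/rr; ring.
  by rewrite -expRD; congr expR; ring.
have l := expR_ge1Dx (- (rr * (x - c))).
have c1 := fixpoint_lt1.
have h : a2 * (x - c) <= x - (1 - expR (- (rr * x))).
  rewrite e /a2; set w := expR _ in l *; nra.
rewrite [X in _ * X]gtr0_norm ?subr_gt0 //.
apply: (@le_trans _ _ (a2 * (x - c))).
  by rewrite ler_wpM2r ?subr_ge0 ?(ltW cx) // ge_min lexx orbT.
by apply: le_trans h _; apply: ler_norm.
Qed.

End Constant.

(** * Expected number of closed sets of a given size *)

Section FirstMoment.
Variables (R : realType) (r : nat).
Hypothesis r2 : (1 < r)%N.

(* Bounds the expected number of closed communicating classes of size [m]; [t] is free. *)
Definition first_moment (t : R) n m : R :=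
  'C(n, m)%:R * ((expR t - 1) ^+ m / (t * n%:R) ^+ (m * r) * ((m * r)`!)%:R).

Let r0 : 0 < r%:R :> R. Proof. by rewrite ltr0n ltnW. Qed.

(* Chernoff bound for the binomial law of parameter [1 - exp (- r m / n)], which is what
   the choice [t = r m / n] leaves after Stirling's formula. *)
Lemma first_moment_le n m : (0 < m <= n)%N ->
  first_moment (r%:R * (m%:R / n%:R)) n m <= expR 1 * (m * r)%:R *
   expR (- (n%:R * (m%:R / n%:R - (1 - expR (- (r%:R * (m%:R / n%:R))))) ^+ 2 / 8)).
Proof.
move=> /andP[m0 mn]; have n0 : (0 < n)%N by exact: leq_trans mn.
have nR : 0 < n%:R :> R by rewrite ltr0n.
have mR : 0 < m%:R :> R by rewrite ltr0n.
set kappa : R := m%:R / n%:R; set t := r%:R * kappa.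
have kn : kappa * n%:R = m%:R by rewrite divfK // gt_eqF.
have tn : t * n%:R = (m * r)%:R by rewrite /t -mulrA kn natrM mulrC.
have k0 : 0 < kappa by rewrite divr_gt0.
have k1 : kappa <= 1 by rewrite ler_pdivrMr // mul1r ler_nat.
have t0 : 0 < t by rewrite mulr_gt0.
set v := expR (- t); set u := 1 - v.
have v0 : 0 < v by rewrite expR_gt0.
have v1 : v < 1 by rewrite expR_lt1 oppr_lt0.
set d := kappa - u.
(* Chernoff tilt. With [m / n = d + u], the exponent per state is at most
   [- d * lambda + 2 * u * lambda ^+ 2]; the choice [d / 4] turns it into [- d^2 / 4 + u d^2 / 8],
   at most [- d^2 / 8] since [u <= 1]. *)
pose lambda := d / 4.
have ev : expR t * v = 1 by rewrite -expRD subrr expR0.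
have N0 : 0 < (m * r)%:R :> R by rewrite ltr0n muln_gt0 m0 ltnW.
(* Since [t n = m r], the Stirling factor [e^(- m r)] is [v^n]. *)
have stir : (m * r)`!%:R / (m * r)%:R ^+ (m * r) <= expR 1 * (m * r)%:R * v ^+ n :> R.
  rewrite ler_pdivrMr ?exprn_gt0 // /v -expRM_natl mulrN [n%:R * _]mulrC tn expRN.
  rewrite mulrAC ler_pdivlMr ?expR_gt0 //.
  by apply: fact_expR_le; rewrite -(ltr_nat R).
have cher : 'C(n, m)%:R * u ^+ m * v ^+ (n - m) <= expR (- (n%:R * d ^+ 2 / 8)).
  have l1 : lambda <= 2^-1 by rewrite /lambda /d /u; nra.
  have el := expR_gt0 lambda.
  have u0 : 0 < u by rewrite subr_gt0.
  have := @binomial_term_le R n m (expR lambda * u) v (ltW (mulr_gt0 el u0)) (ltW v0) mn.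
  rewrite exprMn -expRM_natl => b1.
  have b2 : (expR lambda * u + v) ^+ n <= expR (n%:R * (u * (lambda + 2 * lambda ^+ 2))).
    rewrite expRM_natl lerXn2r ?nnegrE ?expR_ge0 //; first by rewrite addr_ge0 ?mulr_ge0 ?ltW.
    apply: le_trans (expR_ge1Dx _).
    have := expR_le_quad l1; have vE : v = 1 - u by rewrite /u; ring.
    rewrite vE => h; have := ler_wpM2l (ltW u0) h; lra.
  have b3 : expR (m%:R * lambda) * ('C(n, m)%:R * u ^+ m * v ^+ (n - m)) <=
            expR (n%:R * (u * (lambda + 2 * lambda ^+ 2))).
    by apply: le_trans b2; apply: le_trans b1; rewrite le_eqVlt; apply/orP; left; apply/eqP; ring.
  rewrite -ler_pdivlMl ?expR_gt0 // -expRN -expRD in b3.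
  apply: le_trans b3 _; rewrite ler_expR -kn /lambda.
  have : n%:R * ((1 - u) * d ^+ 2) >= 0.
    by apply: mulr_ge0; [exact: ltW|apply: mulr_ge0; [rewrite /u; lra|exact: sqr_ge0]].
  have -> : kappa = d + u by rewrite /d; ring.
  move=> h; lra.
rewrite /first_moment tn.
have -> : expR t - 1 = u * expR t by rewrite /u mulrBl mul1r -ev; ring.
rewrite exprMn.
(* The factor [e^(t m)] cancels [m] of the [n] factors [v], which leaves the binomial term bounded
   in [cher]. *)
have vn : expR t ^+ m * v ^+ n = v ^+ (n - m).
  by rewrite -[in LHS](subnKC mn) exprD mulrA -exprMn ev expr1n mul1r.
apply: (@le_trans _ _ ('C(n, m)%:R * (u ^+ m * expR t ^+ m * (expR 1 * (m * r)%:R * v ^+ n)))).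
  rewrite ler_wpM2l ?ler0n //; rewrite -mulrA ler_wpM2l //.
    by rewrite mulr_ge0 ?exprn_ge0 ?expR_ge0 // subr_ge0 ltW.
  by rewrite mulrC.
rewrite [leLHS](_ : _ = expR 1 * (m * r)%:R * ('C(n, m)%:R * u ^+ m * (expR t ^+ m * v ^+ n)));
  last by ring.
by rewrite vn ler_wpM2l // mulr_ge0 ?expR_ge0 ?ler0n.
Qed.

Lemma first_moment_le_linear n m : (0 < m <= n)%N ->
  first_moment (r%:R * (m%:R / n%:R)) n m <= expR 1 * (m * r)%:R.
Proof.
move=> mn; apply: le_trans (first_moment_le mn) _.
apply: ler_piMr; first by rewrite mulr_ge0 ?expR_ge0 ?ler0n.
rewrite expR_le1 oppr_le0; apply: divr_ge0; last exact: ler0n.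
by apply: mulr_ge0; [exact: ler0n|exact: sqr_ge0].
Qed.

(** For [t = r], the factor [(e^r)^m] cancels the Stirling factor [e^(- m r)]. There remains
    [C(n, m) kappa^(m r)], at most [C(n, m) kappa^(2 m)] as [r >= 2], and
    [C(n, m) kappa^m <= (1 + kappa)^n <= e^m]. *)
Lemma first_moment_small n m : (0 < m <= n)%N ->
  first_moment r%:R n m <= expR 1 * (m * r)%:R * (expR 1 * (m%:R / n%:R)) ^+ m.
Proof.
move=> /andP[m0 mn]; have n0 : (0 < n)%N by exact: leq_trans mn.
have nR : 0 < n%:R :> R by rewrite ltr0n.
set kappa : R := m%:R / n%:R.
have k0 : 0 <= kappa by rewrite divr_ge0 ?ler0n.
have k1 : kappa <= 1 by rewrite ler_pdivrMr // mul1r ler_nat.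
have kn : kappa * n%:R = m%:R by rewrite divfK // gt_eqF.
have rn0 : 0 < r%:R * n%:R :> R by rewrite mulr_gt0.
have b1 : (expR r%:R - 1) ^+ m * (m * r)`!%:R <=
    expR 1 * (m * r)%:R * (m * r)%:R ^+ (m * r) :> R.
  apply: le_trans (@fact_expR_le R (m * r) _); last by rewrite muln_gt0 m0 ltnW.
  rewrite mulrC ler_wpM2l ?ler0n // natrM expRM_natl lerXn2r ?nnegrE ?expR_ge0 //.
  by rewrite gerBl.
have b2 : (m * r)%:R = kappa * (r%:R * n%:R) by rewrite mulrCA kn mulrC -natrM mulnC.
have b3 : 'C(n, m)%:R * kappa ^+ (m * r) <= (expR 1 * kappa) ^+ m :> R.
  apply: (@le_trans _ _ ('C(n, m)%:R * kappa ^+ m * 1 ^+ (n - m) * kappa ^+ m)).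
    rewrite expr1n mulr1 -mulrA ler_wpM2l ?ler0n // -exprD.
    by apply: ler_wiXn2l => //; rewrite addnn -muln2 leq_mul2l r2 orbT.
  rewrite [leRHS]exprMn ler_wpM2r ?exprn_ge0 //.
  apply: le_trans (binomial_term_le k0 ler01 mn) _.
  rewrite -expRM_natl mulr1 -kn mulrC expRM_natl lerXn2r ?nnegrE ?addr_ge0 ?expR_ge0 //.
  by rewrite addrC expR_ge1Dx.
rewrite /first_moment.
apply: (@le_trans _ _ ('C(n, m)%:R * (expR 1 * (m * r)%:R * kappa ^+ (m * r)))).
  rewrite ler_wpM2l ?ler0n // mulrAC ler_pdivrMr ?exprn_gt0 //.
  by apply: le_trans b1 _; rewrite -[leRHS]mulrA -exprMn -b2.
by rewrite mulrCA ler_wpM2l // mulr_ge0 ?expR_ge0 ?ler0n.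
Qed.

End FirstMoment.

(** * Union bounds for closed and periodic classes *)

Section RandomAutomaton.
Variables (R : realType) (r : nat).
Hypothesis r2 : (1 < r)%N.
Local Notation prA n := (@pr R ('I_n * 'I_r)%type 'I_n).

Definition closed_size n (W : pred nat) (tau : {ffun 'I_n * 'I_r -> 'I_n}) :=
  [exists C : {set 'I_n}, W #|C| && cyclic_event [:: C] tau].

(** Disjointness and total size belong to the event: where they fail it is empty, so
    [pr_cyclic_parts] holds for every list. *)
Definition cyclic_parts n (C : {set 'I_n}) P (tau : {ffun 'I_n * 'I_r -> 'I_n}) :=
  [&& disjoint_parts P, (\sum_(T <- P) #|T|)%N == #|C| & cyclic_event P tau].

(** The conclusion of [periodic_cut]. Enumerating [P1] and [P2] separately makes the union bound a
    product of two sums of weights, as in [sum_weight_cut]. *)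
Definition cut_event n (C : {set 'I_n}) (tau : {ffun 'I_n * 'I_r -> 'I_n}) :=
  [exists U : {set 'I_n}, ((U \subset C) && ((5 < #|U|) && (#|U| + 5 < #|C|))%N) &&
    has (fun P1 => has (fun P2 => cyclic_parts C (P1 ++ P2) tau) (ordered_partitions n (C :\: U)))
      (ordered_partitions n U)].

Definition periodic_size n (W : pred nat) (tau : {ffun 'I_n * 'I_r -> 'I_n}) :=
  [exists C : {set 'I_n}, W #|C| && cut_event C tau].

Lemma sum_sets_first_moment n (W : pred nat) (t : nat -> R) (a : nat -> R) :
  \sum_(C : {set 'I_n} | W #|C|) (a #|C| * ((expR (t #|C|) - 1) ^+ #|C| /
     (t #|C| * n%:R) ^+ (#|C| * r) * ((#|C| * r)`!)%:R)) =
  \sum_(m < n.+1 | W m) a m * first_moment r (t m) n m.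
Proof.
pose F m := a m * ((expR (t m) - 1) ^+ m / (t m * n%:R) ^+ (m * r) * ((m * r)`!)%:R).
transitivity (\sum_(C : {set 'I_n} | (C \subset [set: 'I_n]) && W #|C|) F #|C|).
  by apply: eq_bigl => C; rewrite finset.subsetT.
rewrite sum_subsets_card cardsT card_ord; apply: eq_bigr => m _.
rewrite -[LHS]mulr_natl /F /first_moment; ring.
Qed.

Lemma pr_closed_size n (W : pred nat) (t : nat -> R) :
  (forall m, W m -> (m <= n)%N -> 0 < t m) ->
  prA n (closed_size W) <= \sum_(m < n.+1 | W m) first_moment r (t m) n m.
Proof.
move=> tW.
apply: (@le_trans _ _ (\sum_(C : {set 'I_n} | W #|C|) prA n (cyclic_event [:: C]))).
  apply: pr_le_sum => tau /existsP[C h]; apply/hasP; exists C => //.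
under [leRHS]eq_bigr do rewrite -[first_moment _ _ _ _]mul1r.
rewrite -(sum_sets_first_moment n W t (fun=> 1)); apply: ler_sum => C WC; rewrite mul1r.
have tC : 0 < t #|C| by apply: tW => //; rewrite -[leqRHS]card_ord max_card.
by have := @pr_cyclic R 'I_n 'I_r _ [:: C] tC isT; rewrite !big_seq1 !card_ord.
Qed.

Lemma pr_cyclic_parts n (C : {set 'I_n}) P (t : R) : 0 < t ->
  prA n (cyclic_parts C P) <=
  (expR t - 1) ^+ #|C| / (t * n%:R) ^+ (#|C| * r) * weight R r P.
Proof.
move=> t0; have [/andP[dP /eqP sP]|nP] :=
    boolP (disjoint_parts P && ((\sum_(T <- P) #|T|)%N == #|C|)).
  apply: (@le_trans _ _ (prA n (cyclic_event P))).
    by apply: pr_sub => tau /and3P[].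
  have := @pr_cyclic R 'I_n 'I_r _ P t0 dP; rewrite sP !card_ord => /le_trans; apply.
  by rewrite /weight; under eq_bigr do rewrite ?card_ord.
apply: (@le_trans _ _ 0).
  rewrite /pr (_ : [set _ | _] = set0) ?cards0 ?mul0r //; apply/setP => tau.
  by rewrite !inE /cyclic_parts andbA (negbTE nP).
rewrite mulr_ge0 ?weight_ge0 // divr_ge0 ?exprn_ge0 ?mulr_ge0 ?ler0n ?(ltW t0) //.
by rewrite subr_ge0 ltW // expR_gt1.
Qed.

Lemma pr_cut_event n (C : {set 'I_n}) (t : R) : 0 < t ->
  #|C|%:R ^+ 3 * prA n (cut_event C) <= (2 ^ 6 * 6`!)%:R *
  ((expR t - 1) ^+ #|C| / (t * n%:R) ^+ (#|C| * r) * ((#|C| * r)`!)%:R).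
Proof.
move=> t0; set A := _ / _.
have A0 : 0 <= A.
  rewrite divr_ge0 ?exprn_ge0 ?mulr_ge0 ?ler0n ?(ltW t0) //.
  by rewrite subr_ge0 ltW // expR_gt1.
have h : prA n (cut_event C) <= A *
   \sum_(U : {set 'I_n} | (U \subset C) && ((5 < #|U|) && (#|U| + 5 < #|C|))%N)
    ((\sum_(P <- ordered_partitions n U) weight R r P) *
     (\sum_(P <- ordered_partitions n (C :\: U)) weight R r P)).
  rewrite mulr_sumr.
  apply: (@le_trans _ _ (\sum_(U : {set 'I_n} |
      (U \subset C) && ((5 < #|U|) && (#|U| + 5 < #|C|))%N)
      prA n (fun tau => has (fun P1 => has (fun P2 => cyclic_parts C (P1 ++ P2) tau)
        (ordered_partitions n (C :\: U))) (ordered_partitions n U)))).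
    apply: pr_le_sum => tau /existsP[U hU]; apply/hasP; exists U => //.
  apply: ler_sum => U _; rewrite mulr_suml mulr_sumr.
  apply: (@le_trans _ _ (\sum_(P1 <- ordered_partitions n U) prA n (fun tau =>
      has (fun P2 => cyclic_parts C (P1 ++ P2) tau) (ordered_partitions n (C :\: U))))).
    exact: pr_le_sum.
  apply: ler_sum => P1 _; rewrite mulr_sumr mulr_sumr.
  apply: (@le_trans _ _ (\sum_(P2 <- ordered_partitions n (C :\: U))
      prA n (cyclic_parts C (P1 ++ P2)))).
    exact: pr_le_sum.
  apply: ler_sum => P2 _; apply: le_trans (pr_cyclic_parts _ _ t0) _.
  by rewrite /weight big_cat.
apply: le_trans (ler_wpM2l _ h) _; first by rewrite exprn_ge0.
rewrite mulrCA [leRHS]mulrCA ler_wpM2l //; exact: sum_weight_cut.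
Qed.

Lemma pr_periodic_size n (W : pred nat) (t : nat -> R) : ~~ W 0%N ->
  (forall m, W m -> (m <= n)%N -> 0 < t m) ->
  prA n (periodic_size W) <= (2 ^ 6 * 6`!)%:R *
    \sum_(m < n.+1 | W m) m%:R ^- 3 * first_moment r (t m) n m.
Proof.
move=> W0 tW.
apply: (@le_trans _ _ (\sum_(C : {set 'I_n} | W #|C|) prA n (cut_event C))).
  apply: pr_le_sum => tau /existsP[C h]; apply/hasP; exists C => //.
rewrite -(sum_sets_first_moment n W t (fun m => m%:R ^- 3)) mulr_sumr.
apply: ler_sum => C WC.
have tC : 0 < t #|C| by apply: tW => //; rewrite -[leqRHS]card_ord max_card.
have C0 : 0 < #|C|%:R :> R.
  by rewrite ltr0n lt0n; apply: contraNneq W0 => <-.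
rewrite mulrCA ler_pdivlMl ?exprn_gt0 //; exact: pr_cut_event.
Qed.

End RandomAutomaton.

(** * Probabilities of the three bad events *)

Section Tails.
Variables (R : realType) (r : nat) (c : R).
Hypotheses (r2 : (1 < r)%N) (c0 : 0 < c) (cE : c = 1 - expR (- (c * r%:R))).
Local Notation prA n := (@pr R ('I_n * 'I_r)%type 'I_n).

Let r0 : 0 < r%:R :> R. Proof. by rewrite ltr0n ltnW. Qed.

Definition cutoff : R := (8 * expR 1)^-1.

Lemma cutoff_gt0 : 0 < cutoff.
Proof. by rewrite invr_gt0 mulr_gt0 ?expR_gt0. Qed.

Lemma sum_half_le n : \sum_(k < n) 2^-1 ^+ k <= 2 - 2^-1 ^+ n *+ 2 :> R.
Proof.
elim: n => [|n IH]; first by rewrite big_ord0 expr0 subrr.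
rewrite big_ord_recr /= exprS; lra.
Qed.

Definition small_size n m := (0 < m)%N && (m%:R < cutoff * n%:R).
Definition large_size n m := cutoff * n%:R <= m%:R.
Definition deviating_size (eps : R) n m := large_size n m && (eps * n%:R < `|m%:R - c * n%:R|).

Lemma large_size_gt0 n m : (0 < n)%N -> large_size n m -> (0 < m)%N.
Proof.
move=> n0 h; rewrite -(ltr0n R); apply: lt_le_trans h.
by rewrite mulr_gt0 ?cutoff_gt0 ?ltr0n.
Qed.

(** Put [x = e m / n], below [1/8] by the choice of [cutoff]. One factor [x] of [x^m] yields the
    [1 / n]; the rest satisfies [m^2 x^(m-1) <= 4^(m-1) 8^(1-m)], a geometric series of ratio [1/2]
    in [k = m - 1]. *)
Lemma pr_small_size n : (0 < n)%N ->
  prA n (closed_size (small_size n)) <= 2 * expR 1 ^+ 2 * r%:R / n%:R.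
Proof.
move=> n0; have nR : 0 < n%:R :> R by rewrite ltr0n.
apply: le_trans (@pr_closed_size R r n _ (fun=> r%:R) _) _ => //.
pose K : R := expR 1 ^+ 2 * r%:R / n%:R.
have K0 : 0 <= K by rewrite divr_ge0 ?mulr_ge0 ?exprn_ge0 ?expR_ge0 ?ler0n.
apply: (@le_trans _ _ (\sum_(k < n) K * 2^-1 ^+ k)); last first.
  rewrite -mulr_sumr; apply: (@le_trans _ _ (K * 2)); last first.
    by rewrite /K le_eqVlt; apply/orP; left; apply/eqP; ring.
  rewrite ler_wpM2l //; apply: le_trans (sum_half_le n) _.
  by rewrite gerBl mulrn_wge0 // exprn_ge0 // invr_ge0.
rewrite big_mkcond big_ord_recl /= add0r; apply: ler_sum => k _; rewrite /bump leq0n add1n.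
case: ifP => [/andP[_ km]|_]; last by rewrite mulr_ge0 ?exprn_ge0 ?invr_ge0.
have kn : (0 < k.+1 <= n)%N by rewrite ltn_ord.
apply: le_trans (first_moment_small R r2 kn) _.
set x := expR 1 * (_ / _); have e0 := expR_gt0 (1 : R).
have x0 : 0 <= x by rewrite mulr_ge0 ?divr_ge0 ?ler0n ?ltW.
have x8 : x <= 8^-1.
  have km' : k.+1%:R / n%:R <= cutoff by rewrite ler_pdivrMr // ltW.
  apply: le_trans (ler_wpM2l (ltW e0) km') _.
  by rewrite /cutoff invfM mulrCA mulfV ?mulr1 // gt_eqF.
have k2 : k.+1%:R ^+ 2 <= 4 ^+ k :> R.
  rewrite (_ : 4 = 2 ^+ 2); last by ring.
  rewrite -exprM mulnC exprM lerXn2r ?nnegrE ?exprn_ge0 ?ler0n //.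
  by rewrite -natrX ler_nat ltn_expl.
have h : k.+1%:R ^+ 2 * x ^+ k <= 2^-1 ^+ k.
  apply: (@le_trans _ _ (4 ^+ k * 8^-1 ^+ k)).
    by apply: ler_pM; rewrite ?exprn_ge0 ?ler0n // lerXn2r ?nnegrE ?invr_ge0.
  by rewrite -exprMn (_ : 4 * 8^-1 = 2^-1) //; field.
have -> : expR 1 * (k.+1 * r)%:R * x ^+ k.+1 = K * (k.+1%:R ^+ 2 * x ^+ k).
  by rewrite exprS [in X in _ * (X * _)]/x natrM /K; ring.
by rewrite ler_wpM2l.
Qed.

Lemma large_size_ratio n m : (0 < n)%N -> large_size n m -> (m < n.+1)%N ->
  [/\ (0 < m <= n)%N, cutoff <= m%:R / n%:R & m%:R / n%:R <= 1 :> R].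
Proof.
move=> n0 h mn; have nR : 0 < n%:R :> R by rewrite ltr0n.
split; first by rewrite (large_size_gt0 n0 h).
  by rewrite ler_pdivlMr.
by rewrite ler_pdivrMr // mul1r ler_nat.
Qed.

(** By [fixpoint_gap_lb] from [cutoff] on, a deviation [eps] of [m / n] from [c] is a Chernoff
    deviation of at least [a * eps]. The square of [n] counts the sizes and bounds the factor [m] of
    each. *)
Lemma pr_deviating_size : exists2 a : R, 0 < a & forall n eps, (0 < n)%N -> 0 < eps ->
  prA n (closed_size (deviating_size eps n)) <=
  expR 1 * r%:R * n%:R ^+ 2 * expR (- (n%:R * (a * eps) ^+ 2 / 8)).
Proof.
have [a a0 gap] := fixpoint_gap_lb r2 c0 cE cutoff_gt0.
exists a => // n eps n0 eps0; have nR : 0 < n%:R :> R by rewrite ltr0n.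
apply: le_trans (@pr_closed_size R r n _ (fun m => r%:R * (m%:R / n%:R)) _) _.
  move=> m /andP[lm _] mn; have [/andP[m0 _] _ _] := large_size_ratio n0 lm mn.
  by rewrite mulr_gt0 // divr_gt0 ?ltr0n.
pose B : R := expR 1 * r%:R * n%:R * expR (- (n%:R * (a * eps) ^+ 2 / 8)).
apply: (@le_trans _ _ (\sum_(m < n.+1 | deviating_size eps n m) B)); last first.
  apply: le_trans (@sum_nat_pos_const R n _ B _ _) _.
  - by apply/negP => /andP[/(large_size_gt0 n0)].
  - by rewrite !mulr_ge0 ?expR_ge0 ?ler0n.
  by rewrite /B le_eqVlt; apply/orP; left; apply/eqP; ring.
apply: ler_sum => m /andP[lm dm]; have [mn k0 k1] := large_size_ratio n0 lm (ltn_ord m).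
apply: le_trans (first_moment_le R r2 mn) _.
have := gap _ k0 k1; set d := m%:R / n%:R - (1 - _) => hd.
have dlb : a * eps <= `|d|.
  apply: le_trans hd; rewrite ler_wpM2l ?(ltW a0) // -(ler_pM2r nR).
  have -> : `|m%:R / n%:R - c| * n%:R = `|m%:R - c * n%:R|.
    by rewrite -{2}(gtr0_norm nR) -normrM mulrBl divfK ?gt_eqF.
  exact: ltW.
have d2 : (a * eps) ^+ 2 <= d ^+ 2.
  by rewrite -[d ^+ 2]real_normK ?num_real // lerXn2r // nnegrE mulr_ge0 ?ltW.
apply: ler_pM; rewrite ?mulr_ge0 ?expR_ge0 ?ler0n //.
  rewrite natrM -mulrA ler_wpM2l ?expR_ge0 // mulrC ler_wpM2l ?ler0n //.
  by rewrite ler_nat; case/andP: mn.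
by rewrite ler_expR lerN2 ler_pM2r ?invr_gt0 // ler_pM2l.
Qed.

(** The gain [m^-3] against a first moment linear in [m] leaves order [n^-2] for each of at most [n]
    sizes. *)
Lemma pr_periodic_large n : (0 < n)%N ->
  prA n (periodic_size (large_size n)) <=
  (2 ^ 6 * 6`!)%:R * (expR 1 * r%:R / cutoff ^+ 2) / n%:R.
Proof.
move=> n0; have nR : 0 < n%:R :> R by rewrite ltr0n.
have W0 : ~~ large_size n 0 by apply/negP => /(large_size_gt0 n0).
apply: le_trans (@pr_periodic_size R r r2 n _ (fun m => r%:R * (m%:R / n%:R)) W0 _) _.
  move=> m lm mn; have [/andP[m0 _] _ _] := large_size_ratio n0 lm mn.
  by rewrite mulr_gt0 // divr_gt0 ?ltr0n.
rewrite -[leRHS]mulrA ler_wpM2l ?ler0n //.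
pose B : R := expR 1 * r%:R / (cutoff * n%:R) ^+ 2.
have cn : 0 < cutoff * n%:R by rewrite mulr_gt0 ?cutoff_gt0.
apply: (@le_trans _ _ (\sum_(m < n.+1 | large_size n m) B)); last first.
  apply: le_trans (@sum_nat_pos_const R n _ B W0 _) _.
    by rewrite divr_ge0 ?mulr_ge0 ?exprn_ge0 ?expR_ge0 ?ler0n ?ltW ?cutoff_gt0.
  rewrite /B le_eqVlt; apply/orP; left; apply/eqP; field.
  by rewrite !gt_eqF ?cutoff_gt0.
apply: ler_sum => m lm; have [mn k0 k1] := large_size_ratio n0 lm (ltn_ord m).
have mR : 0 < m%:R :> R by rewrite ltr0n; case/andP: mn.
apply: le_trans (ler_wpM2l _ (first_moment_le_linear R r2 mn)) _.
  by rewrite invr_ge0 exprn_ge0 ?ler0n.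
have -> : m%:R ^- 3 * (expR 1 * (m * r)%:R) = expR 1 * r%:R / m%:R ^+ 2 :> R.
  by rewrite natrM; field; rewrite gt_eqF.
rewrite ler_wpM2l ?mulr_ge0 ?expR_ge0 ?ler0n // lef_pV2 ?posrE ?exprn_gt0 //.
by rewrite lerXn2r ?nnegrE // ltW.
Qed.

End Tails.

(** The initial state and the termination bits are free factors that cancel in the ratio; [0 < n]
    makes the number of initial states nonzero. *)
Lemma prob_dfa_trans (R : realType) n r (E : {ffun 'I_n * 'I_r -> 'I_n} -> Prop) : (0 < n)%N ->
  prob_dfa (fun A : dfa n r => E (trans A)) = @pr R _ _ (fun tau => `[< E tau >]).
Proof.
move=> n0; rewrite /prob_dfa /pr.
have -> : [set A : dfa n r | `[< E (trans A) >]] =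
    finset.setX (finset.setX [set: 'I_n] [set tau | `[< E tau >]]) [set: {ffun 'I_n -> bool}].
  by apply/setP => -[[q tau] phi]; rewrite !inE /= andbT.
rewrite !cardsX !cardsT card_ord !card_prod card_ord.
set a := #|[set _ | _]|; set b := #|{ffun _ * _ -> _}|.
have c0 : (0 < #|{ffun 'I_n -> bool}|)%N by rewrite card_ffun expn_gt0 card_bool.
rewrite -!mulnA ![(n * _)%N]mulnC ![((_ * _) * n)%N]mulnC !natrM.
rewrite -mulf_div divff ?mul1r ?pnatr_eq0 -?lt0n //.
by rewrite -mulf_div divff ?mulr1 // pnatr_eq0 -lt0n.
Qed.

(** * Typical automata *)

Section Assembly.
Variables (R : realType) (r : nat) (c : R).
Hypotheses (r2 : (1 < r)%N) (c0 : 0 < c) (cE : c = 1 - expR (- (c * r%:R))).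

Definition typical_automaton n (B : R) (tau : {ffun 'I_n * 'I_r -> 'I_n}) :=
  exists C : {set 'I_n}, closed_comm_class tau C /\
    (forall C', closed_comm_class tau C' -> C' = C) /\
    aperiodic tau C /\ `| #|C|%:R - c * n%:R | <= B.

(* Two closed classes of more than [n / 2] states meet, hence coincide. *)
Lemma typical_automatonP n eps (tau : {ffun 'I_n * 'I_r -> 'I_n}) :
  (0 < n)%N -> (10 * r.+1)%:R < cutoff R * n%:R -> eps < c - 2^-1 ->
  ~~ closed_size (small_size R n) tau -> ~~ closed_size (deviating_size c eps n) tau ->
  ~~ periodic_size (large_size R n) tau -> typical_automaton (eps * n%:R) tau.
Proof.
move=> n0 nbig epsc nsmall ndev nper; have nR : 0 < n%:R :> R by rewrite ltr0n.
have large C : closed_comm_class tau C -> large_size R n #|C|.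
  move=> hC; rewrite /large_size leNgt; apply/negP => Csmall; move/negP: nsmall; apply.
  apply/existsP; exists C; rewrite /small_size Csmall card_gt0.
  by rewrite (closed_comm_class_n0 hC) closed_comm_class_onto // ltnW.
have size C : closed_comm_class tau C -> `| #|C|%:R - c * n%:R | <= eps * n%:R.
  move=> hC; rewrite leNgt; apply/negP => Cdev; move/negP: ndev; apply.
  apply/existsP; exists C; rewrite /deviating_size large // Cdev.
  by rewrite closed_comm_class_onto // ltnW.
have half C : closed_comm_class tau C -> (n < 2 * #|C|)%N.
  move=> /size; rewrite ler_norml => /andP[lo _]; rewrite -(ltr_nat R) natrM.
  have : eps * n%:R < (c - 2^-1) * n%:R by rewrite ltr_pM2r.
  lra.
have [C hC] := closed_comm_class_exists tau n0.
exists C; split=> //; split; [move=> C' hC'|split; [|exact: size]].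
  have [I0|[p]] := set_0Vmem (C :&: C'); last first.
    by rewrite inE => /andP[pC pC']; exact: closed_comm_class_eq hC hC' pC pC'.
  have := max_card (C :|: C'); rewrite cardsU I0 cards0 card_ord.
  by have := half _ hC; have := half _ hC'; lia.
move=> k k1 hk; move/negP: nper; apply; apply/existsP; exists C; rewrite large //=.
have Cbig : (10 * r.+1 < #|C|)%N.
  by rewrite -(ltr_nat R); apply: lt_le_trans nbig (large _ hC).
have [U [P1 [P2 [UC U5 P1U P2U hP]]]] := periodic_cut Cbig hk.
apply/existsP; exists U; rewrite UC U5; apply/hasP; exists P1 => //.
by apply/hasP; exists P2.
Qed.

(** The tolerance [eps = n^(-1/4)] tends to 0 while [n eps^2 = sqrt n] still makes the Chernoff
    factor beat every power of [n]. *)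
Lemma pr_typical_automaton : exists2 K : R, 0 < K & forall n,
  (0 < n)%N -> (10 * r.+1)%:R < cutoff R * n%:R -> (Num.sqrt (Num.sqrt n%:R))^-1 < c - 2^-1 ->
  1 - K / n%:R <= @pr R _ _ (fun tau : {ffun 'I_n * 'I_r -> 'I_n} =>
     `[< typical_automaton ((Num.sqrt (Num.sqrt n%:R))^-1 * n%:R) tau >]).
Proof.
have [a a0 dev] := pr_deviating_size r2 c0 cE.
pose K1 : R := 2 * (expR 1 ^+ 2 * r%:R).
pose K2 : R := expR 1 * r%:R * (6`!%:R * 8 ^+ 6 / a ^+ 12).
pose K3 : R := (2 ^ 6 * 6`!)%:R * (expR 1 * r%:R / cutoff R ^+ 2).
have rR : 0 < r%:R :> R by rewrite ltr0n ltnW.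
have e0 := expR_gt0 (1 : R).
have K10 : 0 < K1 by rewrite !mulr_gt0 ?exprn_gt0.
have K20 : 0 <= K2.
  by rewrite mulr_ge0 ?divr_ge0 ?mulr_ge0 ?exprn_ge0 ?ler0n ?ltW.
have K30 : 0 <= K3.
  by rewrite mulr_ge0 ?ler0n // divr_ge0 ?exprn_ge0 ?mulr_ge0 ?ltW ?cutoff_gt0.
exists (K1 + K2 + K3); first lra.
move=> n n0 nbig epsc; have nR : 0 < n%:R :> R by rewrite ltr0n.
set s := Num.sqrt n%:R in epsc *; set eps := (Num.sqrt s)^-1 in epsc *.
have s0 : 0 < s by rewrite sqrtr_gt0.
have s2 : s ^+ 2 = n%:R by rewrite sqr_sqrtr ?ler0n.
have eps0 : 0 < eps by rewrite invr_gt0 sqrtr_gt0.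
have eps2 : eps ^+ 2 = s^-1 by rewrite exprVn sqr_sqrtr // ltW.
set good := (X in pr _ X).
have goodP tau : ~~ closed_size (small_size R n) tau ->
    ~~ closed_size (deviating_size c eps n) tau ->
    ~~ periodic_size (large_size R n) tau -> good tau.
  by move=> ns nd np; apply/asboolP; exact: typical_automatonP.
clearbody good.
(* Each map is good or in one of three bad events, so the four probabilities add up to at least
   1. *)
pose bads := [:: good; closed_size (small_size R n); closed_size (deviating_size c eps n);
  periodic_size (large_size R n)].
have : pr R (xpredT : pred {ffun 'I_n * 'I_r -> 'I_n}) <= \sum_(E <- bads) pr R E.
  apply: pr_le_sum => tau _; apply: contraT.
  by rewrite /= !negb_or => /and5P[/negP ng ns nd np _]; case: ng; exact: goodP.
have -> : pr R (xpredT : pred {ffun 'I_n * 'I_r -> 'I_n}) = 1.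
  rewrite /pr (_ : [set _ | _] = setT); last by apply/setP => f; rewrite !inE.
  rewrite cardsT divff // pnatr_eq0 -lt0n card_ffun expn_gt0 card_ord n0 //.
rewrite /bads !big_cons big_nil addr0.
have h1 : pr R (closed_size (n := n) (r := r) (small_size R n)) <= K1 / n%:R.
  by apply: le_trans (pr_small_size R r2 n0) _; rewrite /K1 !mulrA.
have h3 : pr R (periodic_size (n := n) (r := r) (large_size R n)) <= K3 / n%:R.
  exact: pr_periodic_large.
have h2 : pr R (closed_size (n := n) (r := r) (deviating_size c eps n)) <= K2 / n%:R.
  apply: le_trans (dev n eps n0 eps0) _.
  set y := n%:R * _ / 8.
  have yE : y = s * (a ^+ 2 / 8).
    by rewrite /y exprMn eps2 -s2; field; rewrite gt_eqF.
  have y0 : 0 < y by rewrite yE mulr_gt0 // divr_gt0 ?exprn_gt0.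
  have y6 : y ^+ 6 = n%:R ^+ 3 * (a ^+ 12 / 8 ^+ 6) by rewrite yE -s2; field.
  (* The sixth power suffices: [y^6] has order [n^3], which turns the prefactor [n^2] into
     [1 / n]. *)
  have hy : y ^+ 6 / 6`!%:R <= expR y.
    by apply: le_trans (expR_ge1Dxn 5 (ltW y0)); rewrite lerDr.
  have f0 : 0 < 6`!%:R :> R by rewrite ltr0n fact_gt0.
  have hy' : expR (- y) <= 6`!%:R / y ^+ 6.
    rewrite expRN -[leRHS]invf_div lef_pV2 ?posrE ?expR_gt0 //.
    by rewrite divr_gt0 ?exprn_gt0.
  apply: (@le_trans _ _ (expR 1 * r%:R * n%:R ^+ 2 * (6`!%:R / y ^+ 6))).
    by rewrite ler_wpM2l // !mulr_ge0 ?exprn_ge0 ?ltW.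
  rewrite y6 /K2 le_eqVlt; apply/orP; left; apply/eqP.
  by set f := 6`!%:R in f0 *; field; rewrite !gt_eqF.
have : (K1 + K2 + K3) / n%:R = K1 / n%:R + K2 / n%:R + K3 / n%:R by rewrite !mulrDl.
lra.
Qed.

End Assembly.

(** * Passage to the limit *)

Local Open Scope classical_set_scope.

Theorem theorem3 (R : realType) (r : nat) (hr : (2 <= r)%N) (c : R)
  (hc0 : 0 < c) (hc : c = 1 - expR (- (c * r%:R))) :
  exists g : nat -> R,
    ((fun n : nat => g n / n%:R) @ \oo --> (0 : R)) /\
    ((fun n : nat => @prob_dfa R n r (fun A =>
        exists C : {set 'I_n},
          closed_comm_class (trans A) C /\
          (forall C', closed_comm_class (trans A) C' -> C' = C) /\
          aperiodic (trans A) C /\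
          `| #|C|%:R - c * n%:R | <= g n)) @ \oo --> (1 : R)).
Proof.
pose eps n : R := (Num.sqrt (Num.sqrt n%:R))^-1.
have eps_small e : 0 < e -> \forall n \near \oo, eps n < e.
  move=> e0; near=> n; have nbig : e ^- 4 < n%:R by near: n; exact: nbhs_infty_gtr.
  have ie4 : 0 < e ^- 4 by rewrite invr_gt0 exprn_gt0.
  have n0 : 0 < n%:R :> R by exact: lt_trans nbig.
  rewrite -[ltRHS]invrK ltf_pV2 ?posrE ?invr_gt0 ?sqrtr_gt0 //.
  have e4 : e^-1 = Num.sqrt (Num.sqrt (e ^- 4)).
    have ei0 : 0 <= e^-1 by rewrite invr_ge0 ltW.
    by rewrite -exprVn (exprM _ 2 2) sqrtr_sqr ger0_norm ?exprn_ge0 // sqrtr_sqr ger0_norm.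
  by rewrite e4 !ltr_sqrt ?sqrtr_gt0.
have [K K0 lb] := pr_typical_automaton hr hc0 hc.
(* This [g] is [n^(3/4)]. *)
exists (fun n => eps n * n%:R); split.
  apply/cvgrPdist_lt => e e0; near=> n.
  have n0 : (0 < n)%N by near: n; exact: nbhs_infty_gt.
  rewrite sub0r normrN mulfK ?pnatr_eq0 -?lt0n // ger0_norm ?invr_ge0 ?sqrtr_ge0 //.
  by near: n; exact: eps_small.
apply/cvgrPdist_le => e e0; near=> n.
have n0 : (0 < n)%N by near: n; exact: nbhs_infty_gt.
have nR : 0 < n%:R :> R by rewrite ltr0n.
have -> := @prob_dfa_trans R n r (typical_automaton c (eps n * n%:R)) n0.
rewrite ger0_norm ?subr_ge0 ?pr_le1 // lerBlDr -lerBlDl.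
apply: (@le_trans _ _ (1 - K / n%:R)); last first.
  apply: lb => //.
    rewrite -ltr_pdivrMl ?cutoff_gt0 //; near: n; exact: nbhs_infty_gtr.
  near: n; apply: eps_small; rewrite subr_gt0; exact: fixpoint_gt_half hr hc0 hc.
(* It suffices that [n >= K / e]. *)
rewrite lerB // ler_pdivrMr // -ler_pdivrMl //.
by near: n; exact: nbhs_infty_ger.
Unshelve. all: by end_near.
Qed.
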